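(* Let $\varepsilon$ be a random variable with distribution $p$ on a measurable space $\mathcal{E}$, let $f:\mathcal{E}\times\mathbb{R}^d\to\mathbb{R}$, and let $F(\theta)=\mathbb{E}_{\varepsilon\sim p}[f(\varepsilon,\theta)]$ with minimizer $\theta^*$; assume all expectations below are finite and gradient and expectation may be interchanged. Let $c:\mathcal{E}\times\mathbb{R}^d\to\mathbb{R}^d$ be a control variate with $\mathbb{E}_{\varepsilon}[c(\varepsilon,\theta)]=0$ for every $\theta$. Assume, for constants $L,H,M>0$: (A1) for every $\varepsilon$, $\theta\mapsto f(\varepsilon,\theta)$ is differentiable and $L$-smooth: $\|\nabla_\theta f(\varepsilon,\theta)-\nabla_\theta f(\varepsilon,\theta')\|_2\le L\|\theta-\theta'\|_2$; (A2) for every $\varepsilon$, $\theta\mapsto f(\varepsilon,\theta)$ is $H$-strongly convex; (A3) for every $\theta$, $\mathbb{E}_{\varepsilon}\big[\|\nabla_\theta f(\varepsilon,\theta^* )-c(\varepsilon,\theta)\|_2^2\big]\le M\,\mathbb{E}_{\varepsilon}\big[f(\varepsilon,\theta)-f(\varepsilon,\theta^* )\big]$. Fix $\theta_0\in\mathbb{R}^d$, let $\varepsilon_0,\varepsilon_1,\dots$ be i.i.d. with law $p$, and define for $t\ge1$ $$\theta_t=\theta_{t-1}-\eta\big(\nabla_\theta f(\varepsilon_{t-1},\theta_{t-1})-c(\varepsilon_{t-1},\theta_{t-1})\big).$$ If $0<\eta\le \frac{1}{2L+M}$ and $\rho=1-\eta H\big(1-\eta(2L+M)\big)$, then for all $t\ge0$,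 $$\mathbb{E}\big[\|\theta_t-\theta^*\|_2^2\big]\le \rho^{\,t}\,\|\theta_0-\theta^*\|_2^2 .$$
   Context: $\nabla_\theta$ is the gradient in the parameter $\theta$. The update is a stochastic (reparameterization-type) gradient step in which the stochastic gradient is corrected by a zero-mean control variate $c$. *)

(* Defs.v *)
From HB Require Import structures.
From mathcomp Require Import all_boot all_order all_algebra.
From mathcomp Require Import all_classical all_reals all_analysis.
Set Implicit Arguments. Unset Strict Implicit. Unset Printing Implicit Defensive.
Import Order.TTheory GRing.Theory Num.Theory.
Import numFieldNormedType.Exports.
Local Open Scope classical_set_scope.
Local Open Scope ring_scope.

Section defs.
Context {R : realType} {d : nat}.

Definition dotv (u v : 'rV[R]_d) : R := \sum_(i < d) u ord0 i * v ord0 i.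
Definition norm2 (u : 'rV[R]_d) : R := Num.sqrt (dotv u u).

Definition is_gradient (g : 'rV[R]_d -> R) (x gv : 'rV[R]_d) : Prop :=
  differentiable g x /\ forall h : 'rV[R]_d, 'd g x h = dotv gv h.

Definition strongly_convex (H : R) (g : 'rV[R]_d -> R) : Prop :=
  forall (x y : 'rV[R]_d) (l : R), 0 <= l <= 1 ->
    g (l *: x + (1 - l) *: y) <=
      l * g x + (1 - l) * g y - H / 2 * l * (1 - l) * (norm2 (x - y)) ^+ 2.

(* identification of R^d as d-tuples (measurable with product Borel sigma-algebra)
   with row vectors *)
Definition mx_of_tuple (x : d.-tuple R) : 'rV[R]_d := \row_i tnth x i.

Fixpoint sgd_iter {E T : Type} (gradf c : E -> 'rV[R]_d -> 'rV[R]_d)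
    (eps : nat -> T -> E) (eta : R) (theta0 : 'rV[R]_d) (t : nat) (w : T)
    : 'rV[R]_d :=
  match t with
  | 0 => theta0
  | t'.+1 => let th := sgd_iter gradf c eps eta theta0 t' w in
             th - eta *: (gradf (eps t' w) th - c (eps t' w) th)
  end.
End defs.

Definition mutually_independent {d1 d0 : measure_display} {T : measurableType d1}
    {E : measurableType d0} {R : realType} (P : probability T R)
    (eps : nat -> T -> E) : Prop :=
  forall (s : seq nat) (A : nat -> set E), uniq s ->
    (forall i, i \in s -> measurable (A i)) ->
    P (\big[setI/setT]_(i <- s) (eps i @^-1` A i)) =
      (\prod_(i <- s) P (eps i @^-1` A i))%E.

Definition identically_distributed {d1 d0 : measure_display} {T : measurableType d1}
    {E : measurableType d0} {R : realType} (P : probability T R)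
    (p : probability E R) (eps : nat -> T -> E) : Prop :=
  forall t (A : set E), measurable A -> P (eps t @^-1` A) = p A.

(* Main.v *)
Require Import Defs.
From HB Require Import structures.
From mathcomp Require Import all_boot all_order all_algebra.
From mathcomp Require Import all_classical all_reals all_analysis.
From mathcomp Require Import measurable_realfun ring lra.
Import Order.TTheory GRing.Theory Num.Theory.
Import numFieldNormedType.Exports.
Local Open Scope classical_set_scope.
Local Open Scope ring_scope.

(** Both gradient inequalities needed, first-order strong convexity and
cocoercivity, come from the two-sided descent lemma
[|g (x + h) - g x - <dg x, h>| <= L / 2 |h|^2].  With [D = f e x - f e x*] and
[h = x - x*], cocoercivity gives the pointwise bound
[|dg - c|^2 <= 4 L (D - <dg*, h>) + 2 |dg* - c|^2].  After averaging over [e],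
the cross terms vanish (zero mean of [c], stationarity of [x*]), (A3) bounds the
last term by [2 M E D], and [E |x - eta (dg - c) - x*|^2] is at most
[(1 - eta H) |h|^2 - 2 eta (1 - eta (2 L + M)) E D], hence at most [rho |h|^2].
This one-step contraction is transported to the iterates because the pair
(current noise, current iterate) has the product law, so that Tonelli's theorem
lets one integrate over the fresh noise first. *)

(** * Smooth strongly convex functions *)

Section euclidean.
Context {R : realType} {d : nat}.
Implicit Types (u v w : 'rV[R]_d) (a : R).

Lemma dotvC u v : dotv u v = dotv v u.
Proof. by apply: eq_bigr => i _; rewrite mulrC. Qed.

Lemma dotvDl u v w : dotv (u + v) w = dotv u w + dotv v w.
Proof. by rewrite -big_split; apply: eq_bigr => i _; rewrite mxE mulrDl. Qed.

Lemma dotvZl a u w : dotv (a *: u) w = a * dotv u w.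
Proof. by rewrite /dotv mulr_sumr; apply: eq_bigr => i _; rewrite mxE mulrA. Qed.

Lemma dotvNl u w : dotv (- u) w = - dotv u w.
Proof. by rewrite -scaleN1r dotvZl mulN1r. Qed.

Lemma dotvDr u v w : dotv u (v + w) = dotv u v + dotv u w.
Proof. by rewrite !(dotvC u) dotvDl. Qed.

Lemma dotvZr a u w : dotv u (a *: w) = a * dotv u w.
Proof. by rewrite !(dotvC u) dotvZl. Qed.

Lemma dotvNr u w : dotv u (- w) = - dotv u w.
Proof. by rewrite !(dotvC u) dotvNl. Qed.

Lemma dotvBl u v w : dotv (u - v) w = dotv u w - dotv v w.
Proof. by rewrite dotvDl dotvNl. Qed.

Definition dotvE := (dotvDl, dotvDr, dotvZl, dotvZr, dotvNl, dotvNr).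

Lemma dotvv_ge0 u : 0 <= dotv u u.
Proof. by apply: sumr_ge0 => i _; rewrite -expr2 sqr_ge0. Qed.

Lemma dotvv_eq0 u : dotv u u = 0 -> u = 0.
Proof.
move=> /eqP; rewrite psumr_eq0 => [/allP h|i _]; last by rewrite -expr2 sqr_ge0.
apply/rowP => i; rewrite mxE; apply/eqP.
by have := h i (mem_index_enum i); rewrite /= mulf_eq0 orbb.
Qed.

Lemma norm2_ge0 u : 0 <= norm2 u.
Proof. exact: sqrtr_ge0. Qed.

Lemma norm2N u : norm2 (- u) = norm2 u.
Proof. by rewrite /norm2 dotvNl dotvNr opprK. Qed.

Lemma norm2_sqr u : norm2 u ^+ 2 = dotv u u.
Proof. by rewrite sqr_sqrtr // dotvv_ge0. Qed.

Lemma norm2_sqrB_le u v w :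
  dotv (u - w) (u - w) <= 2 * dotv (u - v) (u - v) + 2 * dotv (v - w) (v - w).
Proof.
have := dotvv_ge0 (u - v - (v - w)).
have -> : u - w = (u - v) + (v - w) by rewrite addrA subrK.
move: (u - v) (v - w) => x y; rewrite !dotvE (dotvC y x); lra.
Qed.

End euclidean.

(** * Descent lemma for functions with Lipschitz gradient *)

Section smooth_convex.
Context {R : realType} {d : nat}.
Variables (g : 'rV[R]_d -> R) (dg : 'rV[R]_d -> 'rV[R]_d) (L : R).
Hypothesis L0 : 0 < L.
Hypothesis gradg : forall x, is_gradient g x (dg x).
Hypothesis lip : forall x y, norm2 (dg x - dg y) <= L * norm2 (x - y).

Lemma lipschitz_sqr x y :
  dotv (dg x - dg y) (dg x - dg y) <= L ^+ 2 * dotv (x - y) (x - y).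
Proof.
rewrite -!norm2_sqr -exprMn lerXn2r ?nnegrE ?norm2_ge0 ?lip //.
by rewrite mulr_ge0 ?norm2_ge0 // ltW.
Qed.

(** Up to reordering sums, the difference quotient at [s] along the line is that of [g] at
    [x + s *: h] in direction [h]. *)
Lemma is_derive_line x h (s : R) :
  is_derive s 1 (fun t : R => g (x + t *: h)) (dotv (dg (x + s *: h)) h).
Proof.
have [dgx dgE] := gradg (x + s *: h).
have <- : 'D_h g (x + s *: h) = dotv (dg (x + s *: h)) h by rewrite deriveE.
have gd : derivable g (x + s *: h) h by exact: diff_derivable.
have E : (fun t : R => t^-1 *: (g (x + (t *: (1 : R) + s) *: h) - g (x + s *: h)))
   = (fun t : R => t^-1 *: (g (t *: h + (x + s *: h)) - g (x + s *: h))).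
  apply/funext => t; congr (_ *: (g _ - _)).
  by rewrite [t *: 1]mulr1 scalerDl addrCA.
split; first by rewrite /derivable /= E; exact: gd.
by rewrite /derive /= E.
Qed.

(** Along the segment, subtracting the linear part and the quadratic bound from [g] leaves [phi]
    with nonpositive derivative on the open interval, so the mean value theorem gives
    [phi 1 <= phi 0]. *)
Lemma descent_upper x h :
  g (x + h) <= g x + dotv (dg x) h + L / 2 * dotv h h.
Proof.
pose phi := fun s : R => g (x + s *: h) - s * dotv (dg x) h - s ^+ 2 * (L / 2 * dotv h h).
pose dphi := fun s : R => dotv (dg (x + s *: h)) h - dotv (dg x) h - s * (L * dotv h h).
have dphiP (s : R) : is_derive s 1 phi (dphi s).
  have := is_derive_line x h s => ?.
  rewrite /phi; apply: is_derive_eq.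
  by rewrite /dphi /GRing.scale /=; field.
have cphi : {within `[0, 1], continuous phi}.
  apply: derivable_within_continuous => r _.
  by have [] := dphiP r.
have [s] := MVT ltr01 (fun s _ => dphiP s) cphi.
rewrite in_itv /= => /andP[s0 _]; rewrite subr0 mulr1 => E.
suff : dphi s <= 0.
  rewrite -E /phi scale1r scale0r addr0 !expr2; lra.
set u := dg (x + s *: h) - dg x.
have uE : dotv u h = dotv (dg (x + s *: h)) h - dotv (dg x) h by rewrite !dotvE.
have u2 : dotv u u <= (L * s) ^+ 2 * dotv h h.
  apply: le_trans (lipschitz_sqr _ _) _.
  by rewrite addrC addKr !dotvE exprMn !expr2 !mulrA.
(* The mean value point is interior, so [L * s] is positive and can be cancelled at the end. *)
have Ls0 : 0 < L * s by rewrite mulr_gt0.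
clearbody u.
(* AM-GM replaces Cauchy-Schwarz here. *)
have := dotvv_ge0 (u - (L * s) *: h).
rewrite !dotvE (dotvC h u) => sq.
have : (L * s) * dotv u h <= (L * s) * (L * s * dotv h h).
  by move: u2 sq; move: (dotv u u) (dotv u h) (dotv h h) (L * s) => a b c k; rewrite expr2; lra.
rewrite ler_pM2l // uE /dphi; lra.
Qed.

End smooth_convex.

Lemma is_gradientN {R : realType} {d : nat} (g : 'rV[R]_d -> R) x v :
  is_gradient g x v -> is_gradient (fun y => - g y) x (- v).
Proof.
move=> [dg dgE]; split; first exact: differentiableN.
by move=> h; rewrite (diffN dg) /= dotvNl -dgE.
Qed.

(** * First-order strong convexity and cocoercivity *)

Section smooth_strongly_convex.
Context {R : realType} {d : nat}.
Variables (g : 'rV[R]_d -> R) (dg : 'rV[R]_d -> 'rV[R]_d) (L : R).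
Hypothesis L0 : 0 < L.
Hypothesis gradg : forall x, is_gradient g x (dg x).
Hypothesis lip : forall x y, norm2 (dg x - dg y) <= L * norm2 (x - y).

(** This is [descent_upper] for [- g], whose gradient has the same Lipschitz constant. *)
Lemma descent_lower x h :
  g x + dotv (dg x) h - L / 2 * dotv h h <= g (x + h).
Proof.
have := @descent_upper R d (fun y => - g y) (fun y => - dg y) L L0
  (fun y => is_gradientN _ _ _ (gradg y)).
have lipN y z : norm2 (- dg y - - dg z) <= L * norm2 (y - z).
  by rewrite -opprD norm2N lip.
move=> /(_ lipN x h); rewrite dotvNl; lra.
Qed.

Variable (H : R).
Hypothesis H0 : 0 < H.
Hypothesis cvx : strongly_convex H g.

(** Compare strong convexity at [x + l *: h] with [descent_lower] there and divide by [l]: the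
    inequality holds up to an error linear in [l], which can be made arbitrarily small. *)
Lemma strongly_convex_gradient_le x y :
  g x + dotv (dg x) (y - x) + H / 2 * dotv (y - x) (y - x) <= g y.
Proof.
set h := y - x.
have key l : 0 < l -> l <= 1 ->
  g x + dotv (dg x) h + H / 2 * dotv h h <= g y + l * ((L + H) / 2 * dotv h h).
  move=> l0 l1; rewrite -(ler_pM2l l0).
  have := cvx y x l; rewrite (ltW l0) l1 => /(_ isT).
  have -> : l *: y + (1 - l) *: x = x + l *: h.
    by rewrite /h scalerBl scale1r scalerBr addrCA addrA addrAC -addrA (addrC x).
  have := descent_lower x (l *: h).
  rewrite norm2_sqr -/h !dotvE => lo up.
  have := le_trans lo up.
  move: (g x) (g y) (dotv _ _) (dotv h h) => a b c e; lra.
rewrite leNgt; apply/negP => lt.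
set a := _ + _ in lt; set b := (L + H) / 2 * dotv h h in key.
have b0 : 0 <= b by rewrite mulr_ge0 ?dotvv_ge0 // divr_ge0 // addr_ge0 // ltW.
have ab : 0 < a - g y by rewrite subr_gt0.
have p0 : 0 < a - g y + b + b by lra.
(* Chosen so that [l * b < (a - g y) / 2], which contradicts [key]; the denominator stays positive
   when [b = 0]. *)
pose l := (a - g y) / (a - g y + b + b).
have l0 : 0 < l by rewrite divr_gt0.
have l1 : l <= 1 by rewrite ler_pdivrMr //; lra.
have := key l l0 l1.
have lE : l * (a - g y + b + b) = a - g y by rewrite divfK // gt_eqF.
rewrite -/a.
nra.
Qed.

(** Subtracting from [g] its linear part at [x] gives a convex function minimized at [x]; a gradient
    step of length [L^-1] from [y] lowers it by at least [dotv u u / (2 * L)]. *)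
Lemma cocoercive x y :
  dotv (dg y - dg x) (dg y - dg x) <= 2 * L * (g y - g x - dotv (dg x) (y - x)).
Proof.
set u := dg y - dg x.
pose z := y - L^-1 *: u.
have lo := strongly_convex_gradient_le x z.
have := @descent_upper R d g dg L L0 gradg lip y (- (L^-1 *: u)).
rewrite -/z => up.
have q0 : 0 <= H / 2 * dotv (z - x) (z - x).
  by rewrite mulr_ge0 ?dotvv_ge0 // divr_ge0 // ltW.
have {}lo : g x + dotv (dg x) (z - x) <= g z by apply: le_trans lo; rewrite lerDl.
have {lo up} := le_trans lo up.
have -> : z - x = (y - x) - L^-1 *: u by rewrite /z addrAC.
have uE : dotv u u = dotv (dg y) u - dotv (dg x) u by rewrite -dotvNl -dotvDl.
clear q0 z; clearbody u; move: (y - x) => w h.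
have {}h : g x + (dotv (dg x) w - L^-1 * dotv (dg x) u) <=
  g y - L^-1 * dotv (dg y) u + L / 2 * (L^-1 * (L^-1 * dotv u u)).
  by move: h; rewrite !dotvE; lra.
have Ln0 : L != 0 by rewrite gt_eqF.
have E : L / 2 * (L^-1 * (L^-1 * dotv u u)) = L^-1 * dotv u u / 2 by field.
have {}h : L^-1 * dotv u u <= 2 * (g y - g x - dotv (dg x) w).
  have uE' : L^-1 * dotv u u = L^-1 * dotv (dg y) u - L^-1 * dotv (dg x) u.
    by rewrite -mulrBr -uE.
  move: h uE'; rewrite E.
  move: (L^-1 * dotv u u) (L^-1 * dotv (dg x) u) (L^-1 * dotv (dg y) u) => a b e.
  lra.
by rewrite -(ler_pM2l L0) in h; move: h; rewrite mulrA divff // mul1r; lra.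
Qed.

End smooth_strongly_convex.

(** * Independence of the current noise and the current iterate *)

Section independence.
Local Open Scope ereal_scope.
Context {R : realType} {d0 d1 d2 : measure_display}.
Context {E : measurableType d0} {T : measurableType d1} {S : measurableType d2}.
Variables (p : probability E R) (P : probability T R).

Lemma joint_law_restr (Y : T -> E) (X : {mfun T >-> S}) (C : set T) :
  measurable_fun setT Y -> measurable C ->
  (forall A B, measurable A -> measurable B ->
    P (X @^-1` B `&` (Y @^-1` A `&` C)) = P (X @^-1` B) * (p A * P C)) ->
  forall W, measurable W ->
    P ((fun w => (Y w, X w)) @^-1` W `&` C) = (p \x distribution P X) W * P C.
Proof.
move=> mY mC indep W mW.
have mYX : measurable_fun setT (fun w => (Y w, X w)).
  by apply: measurable_fun_pair.
pose YX : {mfun T >-> (E * S)%type} :=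
  HB.pack (fun w => (Y w, X w)) (isMeasurableFun.Build _ _ _ _ _ mYX).
have PCfin : P C \is a fin_num by exact: fin_num_measure.
pose k : {nonneg R} := NngNum (fine_ge0 (measure_ge0 P C)).
have kE : k%:num%:E = P C by rewrite /= fineK.
have := @product_measure_unique _ _ _ _ R (mscale k p) (distribution P X)
  (pushforward (mrestr P mC) YX).
move=> uniq.
have /uniq/(_ W mW) : forall A B, measurable A -> measurable B ->
    pushforward (mrestr P mC) YX (A `*` B) = mscale k p A * distribution P X B.
  move=> A B mA mB; rewrite /pushforward /mrestr /distribution /pushforward /mscale.
  rewrite kE.
  transitivity (P (X @^-1` B `&` (Y @^-1` A `&` C))).
    by congr (P _); apply/seteqP; split => w /=; [move=> [[]]|move=> [? []]].
  by rewrite indep// muleC (muleC (p A)).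
move=> prodE; transitivity ((mscale k p \x distribution P X) W).
  by rewrite prodE.
rewrite /product_measure1 ge0_integral_mscale//; last first.
  exact: measurable_fun_xsection.
by rewrite muleC kE.
Qed.

Variables (eps : nat -> T -> E) (X : nat -> T -> S) (Phi : E * S -> S) (x0 : S).
Hypotheses (meps : forall t, measurable_fun setT (eps t))
  (indep : mutually_independent P eps) (idist : identically_distributed P p eps)
  (mPhi : measurable_fun setT Phi)
  (X0 : X 0 = cst x0) (XS : forall t w, X t.+1 w = Phi (eps t w, X t w)).

Lemma measurable_recursion t : measurable_fun setT (X t).
Proof.
elim: t => [|t IH]; first by rewrite X0.
have -> : X t.+1 = Phi \o (fun w => (eps t w, X t w)) by apply/funext => w /=.
by apply: measurableT_comp => //; apply: measurable_fun_pair.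
Qed.

Let cylinder (A : nat -> set E) (s : seq nat) : set T :=
  \big[setI/setT]_(i <- s) (eps i @^-1` A i).

Let mcylinder A s : (forall i, measurable (A i)) -> measurable (cylinder A s).
Proof.
move=> mA; apply: bigsetI_measurable => i _.
by rewrite -[X in measurable X]setTI; exact: meps.
Qed.

(* Carrying the whole cylinder over the later noises makes independence of the
   iterate inductive using only uniqueness of product measures. *)
Let future_indep t := forall A s B, (forall i, measurable (A i)) -> uniq s ->
  {in s, forall i, (t <= i)%N} -> measurable B ->
  P (X t @^-1` B `&` cylinder A s) = P (X t @^-1` B) * P (cylinder A s).

Let cylinder_cons A t s : (forall i, measurable (A i)) -> uniq (t :: s) ->
  P (cylinder A (t :: s)) = p (A t) * P (cylinder A s).
Proof.
move=> mA uts; have us : uniq s by case/andP: uts.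
have mAs (r : seq nat) i : i \in r -> measurable (A i) by move=> _; exact: mA.
by rewrite /cylinder (indep _ _ uts (mAs _)) (indep _ _ us (mAs _)) big_cons idist.
Qed.

(** On a rectangle, the event on [eps t] joins the cylinder as one more coordinate, and
    [future_indep t] separates that cylinder from [X t]. *)
Let joint_law_cylinder t (Xt : {mfun T >-> S}) : X t = Xt -> future_indep t ->
  forall A s W, (forall i, measurable (A i)) -> uniq s ->
  {in s, forall i, (t < i)%N} -> measurable W ->
  P ((fun w => (eps t w, X t w)) @^-1` W `&` cylinder A s) =
  (p \x distribution P Xt) W * P (cylinder A s).
Proof.
move=> XE IH A s W mA us ts mW; rewrite XE.
apply: joint_law_restr => //; first exact: mcylinder.
move=> A' B mA' mB.
(* Since [t] is not in [s], changing [A] at [t] leaves the cylinder over [s] intact. *)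
pose A2 i := if i == t then A' else A i.
have mA2 i : measurable (A2 i) by rewrite /A2; case: ifP.
have tNs : t \notin s by apply/negP => /ts; rewrite ltnn.
have A2s : cylinder A2 s = cylinder A s.
  apply: eq_big_seq => i si; rewrite /A2; case: eqVneq => // it.
  by rewrite -it si in tNs.
have us2 : uniq (t :: s) by rewrite /= tNs.
have -> : eps t @^-1` A' `&` cylinder A s = cylinder A2 (t :: s).
  by rewrite /cylinder big_cons -/(cylinder A2 s) A2s /A2 eqxx.
rewrite -XE IH //; last by move=> i; rewrite inE => /predU1P[->//|/ts/ltnW].
by rewrite cylinder_cons // A2s /A2 eqxx.
Qed.

Let cylinder_nil A : cylinder A [::] = setT.
Proof. by rewrite /cylinder big_nil. Qed.

(** A constant is independent of everything; for the step, an event on [X t.+1] is one on the pair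
    [(eps t, X t)], whose joint law with later noises is known. *)
Let future_indepP t : future_indep t.
Proof.
elim: t => [|t IH] A s B mA us ts mB.
  rewrite X0 preimage_cst; case: ifP => _.
    by rewrite setTI probability_setT mul1e.
  by rewrite set0I measure0 mul0e.
pose Xt : {mfun T >-> S} :=
  HB.pack (X t) (isMeasurableFun.Build _ _ _ _ _ (measurable_recursion t)).
pose W := Phi @^-1` B.
have mW : measurable W by rewrite -[W]setTI; exact: mPhi.
have -> : X t.+1 @^-1` B = (fun w => (eps t w, X t w)) @^-1` W.
  by apply/seteqP; split => w /=; rewrite XS.
have law := joint_law_cylinder t Xt erefl IH.
rewrite law //; congr (_ * _).
(* The empty cylinder identifies the product measure of [W] with the probability of the event. *)
have := law A [::] W mA isT (fun _ => ltac:(done)) mW.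
by rewrite cylinder_nil setIT probability_setT mule1.
Qed.

Lemma recursion_joint_law t (Xt : {mfun T >-> S}) : X t = Xt ->
  forall W, measurable W ->
  P ((fun w => (eps t w, X t w)) @^-1` W) = (p \x distribution P Xt) W.
Proof.
move=> XE W mW.
have := joint_law_cylinder t Xt XE (future_indepP t) (fun=> setT) [::] W
  (fun _ => measurableT) isT (fun _ => ltac:(done)) mW.
by rewrite cylinder_nil setIT probability_setT mule1.
Qed.

(** Replaces conditioning on [X t]: the pair has the product law, and Tonelli puts the fresh noise
    in the inner integral. *)
Lemma recursion_ge0_expectation t (Xt : {mfun T >-> S}) (h : S -> R) :
  X t = Xt -> measurable_fun setT h -> (forall x, 0 <= h x)%R ->
  \int[P]_w (h (X t.+1 w))%:E =
  \int[distribution P Xt]_x \int[p]_e (h (Phi (e, x)))%:E.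
Proof.
move=> XE mh h0.
have mYX : measurable_fun setT (fun w => (eps t w, X t w)).
  by apply: measurable_fun_pair => //; exact: measurable_recursion.
pose YX : {mfun T >-> (E * S)%type} :=
  HB.pack (fun w => (eps t w, X t w)) (isMeasurableFun.Build _ _ _ _ _ mYX).
pose hPhi z := (h (Phi z))%:E.
have mhPhi : measurable_fun setT hPhi.
  by apply/measurable_EFinP; exact: measurableT_comp.
have hPhi0 z : 0 <= hPhi z by rewrite lee_fin.
transitivity (\int[distribution P YX]_z hPhi z).
  rewrite ge0_integral_distribution//.
  by apply: eq_integral => w _ /=; rewrite XS.
rewrite -(fubini_tonelli2 hPhi) //.
apply: eq_measure_integral => W mW _.
exact: recursion_joint_law.
Qed.
End independence.

(** * Contraction of one step *)

Section mean.
#[local] Set Implicit Arguments.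
Local Open Scope ereal_scope.
Context {R : realType} {d0 : measure_display} {E : measurableType d0}.
Variable p : probability E R.

(** Integrability is bundled with a real value, so means of linear combinations are computed in [R]
    instead of the extended reals. *)
Definition has_mean (X : E -> R) (m : R) :=
  p.-integrable setT (fun e => (X e)%:E) /\ \int[p]_e (X e)%:E = m%:E.

Lemma integrable_has_mean X :
  p.-integrable setT (fun e => (X e)%:E) -> has_mean X (fine 'E_p[X]).
Proof. by move=> iX; split=> //; rewrite unlock fineK // integrable_fin_num. Qed.

Lemma has_mean_cst r : has_mean (fun=> r) r.
Proof.
split; first exact: finite_measure_integrable_cst.
by rewrite integral_cst //= probability_setT mule1.
Qed.

Lemma has_meanD X Y m n : has_mean X m -> has_mean Y n ->
  has_mean (fun e => X e + Y e)%R (m + n).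
Proof.
move=> [iX mX] [iY mY]; split; last by rewrite integralD_EFin // mX mY.
by under eq_fun do rewrite EFinD; exact: integrableD.
Qed.

Lemma has_meanZ k X m : has_mean X m -> has_mean (fun e => k * X e)%R (k * m).
Proof.
move=> [iX mX]; split; first by under eq_fun do rewrite EFinM; exact: integrableZl.
by under eq_integral do rewrite EFinM; rewrite integralZl // mX.
Qed.

Lemma has_meanB X Y m n : has_mean X m -> has_mean Y n ->
  has_mean (fun e => X e - Y e)%R (m - n).
Proof.
move=> hX hY; have := has_meanD hX (has_meanZ (-1)%R hY).
by rewrite mulN1r; under eq_fun do rewrite mulN1r.
Qed.

Lemma has_mean_sum n (X : 'I_n -> E -> R) (m : 'I_n -> R) :
  (forall i, has_mean (X i) (m i)) ->
  has_mean (fun e => \sum_(i < n) X i e)%R (\sum_(i < n) m i).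
Proof.
elim: n X m => [|n IH] X m hX.
  by rewrite big_ord0; under eq_fun do rewrite big_ord0; exact: has_mean_cst.
rewrite big_ord_recl; under eq_fun do rewrite big_ord_recl.
by apply: has_meanD => //; exact: IH.
Qed.

Lemma has_mean_dotv n (X : E -> 'rV[R]_n) (m h : 'rV[R]_n) :
  (forall i, has_mean (fun e => X e ord0 i) (m ord0 i)) ->
  has_mean (fun e => dotv (X e) h) (dotv m h).
Proof.
move=> hX; apply: has_mean_sum => i; rewrite mulrC.
by under eq_fun do rewrite mulrC; exact: has_meanZ.
Qed.

Lemma has_mean_le X Y m n : has_mean X m -> has_mean Y n ->
  (forall e, X e <= Y e)%R -> (m <= n)%R.
Proof.
move=> [iX mX] [iY mY] XY; rewrite -lee_fin -mX -mY.
by apply: le_integral => // e _; rewrite lee_fin.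
Qed.

End mean.

(** * Mean squared distance after one update *)

Section one_step.
Context {R : realType} {d : nat} {d0 : measure_display} {E : measurableType d0}.
Variables (p : probability E R) (f : E -> 'rV[R]_d -> R)
  (gradf c : E -> 'rV[R]_d -> 'rV[R]_d) (thetastar : 'rV[R]_d) (L H M eta : R).
Hypotheses
  (intf : forall theta, p.-integrable setT (fun e => (f e theta)%:E))
  (intg : forall theta i, p.-integrable setT (fun e => (gradf e theta ord0 i)%:E))
  (intc : forall theta i, p.-integrable setT (fun e => (c e theta ord0 i)%:E))
  (intv : forall theta, p.-integrable setT
      (fun e => ((norm2 (gradf e thetastar - c e theta)) ^+ 2)%:E))
  (fmin : forall theta, ('E_p[fun e => f e thetastar] <= 'E_p[fun e => f e theta])%E)
  (meanc : forall theta i, ('E_p[fun e => c e theta ord0 i] = 0)%E)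
  (L0 : 0 < L) (H0 : 0 < H) (M0 : 0 < M)
  (gradP : forall e theta, is_gradient (f e) theta (gradf e theta))
  (lip : forall e theta theta',
    norm2 (gradf e theta - gradf e theta') <= L * norm2 (theta - theta'))
  (cvx : forall e, strongly_convex H (f e))
  (varc : forall theta, ('E_p[fun e => ((norm2 (gradf e thetastar - c e theta)) ^+ 2)%R]
                  <= M%:E * 'E_p[fun e => (f e theta - f e thetastar)%R])%E)
  (eta0 : 0 < eta) (eta1 : eta <= 1 / (2 * L + M)).

Let F theta := fine ('E_p[fun e => f e theta])%E.

Let meanF theta : has_mean p (fun e => f e theta) (F theta).
Proof. exact: integrable_has_mean. Qed.

Let F_min theta : F thetastar <= F theta.
Proof.
have := fmin theta; rewrite unlock.
by have [[_ ->] [_ ->]] := (meanF thetastar, meanF theta); rewrite lee_fin.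
Qed.

(* Integrating the descent inequality shows that
   [0 <= <m, h> + L / 2 |h|^2] for all [h], where [m] is the mean gradient at
   the minimizer; take [h = - m / L]. *)
Lemma mean_gradient_minimizer h :
  has_mean p (fun e => dotv (gradf e thetastar) h) 0.
Proof.
pose m : 'rV[R]_d := \row_i fine ('E_p[fun e => gradf e thetastar ord0 i])%E.
have mean_m k : has_mean p (fun e => dotv (gradf e thetastar) k) (dotv m k).
  by apply: has_mean_dotv => i; rewrite mxE; exact: integrable_has_mean.
suff m0 : m = 0 by have := mean_m h; rewrite m0 /dotv big1 // => i _; rewrite mxE mul0r.
apply: dotvv_eq0.
pose k := - (L^-1 *: m).
have le : F (thetastar + k) <= F thetastar + dotv m k + L / 2 * dotv k k.
  apply: has_mean_le (meanF _) _ _.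
    by apply: has_meanD; [exact: has_meanD|exact: has_mean_cst].
  by move=> e; exact: descent_upper.
have {}le := le_trans (F_min _) le.
have mk : dotv m k = - (L^-1 * dotv m m) by rewrite /k dotvNr dotvZr.
have Ln0 : L != 0 by rewrite gt_eqF.
have kk : L / 2 * dotv k k = L^-1 * dotv m m / 2.
  by rewrite /k dotvNl dotvNr dotvZl dotvZr; field.
apply/eqP; rewrite eq_le dotvv_ge0 andbT -(ler_pM2l (x := L^-1)) ?invr_gt0 //.
by move: le; rewrite mk kk mulr0; lra.
Qed.

(** Expand the square, bound [dotv (gradf e x) h] below by strong convexity and the squared
    corrected gradient above by cocoercivity. The bound is linear in quantities with known or
    controlled means. *)
Lemma step_sqr_le e x (h := x - thetastar) :
  norm2 (x - eta *: (gradf e x - c e x) - thetastar) ^+ 2 <=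
  (1 - eta * H) * dotv h h +
  (4 * L * eta ^+ 2 - 2 * eta) * (f e x - f e thetastar) +
  2 * eta * dotv (c e x) h - 4 * L * eta ^+ 2 * dotv (gradf e thetastar) h +
  2 * eta ^+ 2 * norm2 (gradf e thetastar - c e x) ^+ 2.
Proof.
have sc := strongly_convex_gradient_le _ _ _ L0 (gradP e) (lip e) _ H0 (cvx e) x thetastar.
have co := cocoercive _ _ _ L0 (gradP e) (lip e) _ H0 (cvx e) thetastar x.
have tri := norm2_sqrB_le (gradf e x) (gradf e thetastar) (c e x).
have -> : x - eta *: (gradf e x - c e x) - thetastar = h - eta *: (gradf e x - c e x).
  by rewrite /h addrAC.
rewrite -/h -(opprB x) -/h !(dotvNr, dotvNl) opprK in sc co.
clearbody h.
rewrite !norm2_sqr.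
move: (dotv (gradf e thetastar - c e x) _) (dotv (gradf e x - gradf e thetastar) _) tri co
  => V W tri co.
have -> : dotv (h - eta *: (gradf e x - c e x)) (h - eta *: (gradf e x - c e x)) =
  dotv h h - 2 * eta * (dotv (gradf e x) h - dotv (c e x) h)
  + eta ^+ 2 * dotv (gradf e x - c e x) (gradf e x - c e x).
  move: (gradf e x - c e x) (dotvBl (gradf e x) (c e x) h) => u <-.
  by rewrite !dotvE (dotvC h u); ring.
move: (dotv (gradf e x - c e x) _) tri => U tri.
have e2 : 0 < eta ^+ 2 by rewrite exprn_gt0.
have U2 : eta ^+ 2 * U <= eta ^+ 2 *
  (4 * L * (f e x - f e thetastar - dotv (gradf e thetastar) h) + 2 * V).
  by rewrite ler_pM2l //; lra.
have S2 : eta * (f e x - f e thetastar + H / 2 * dotv h h) <= eta * dotv (gradf e x) h.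
  by rewrite ler_pM2l //; lra.
move: U2 S2; rewrite -subr_ge0 => U2; rewrite -subr_ge0 => S2.
(* The difference of the two sides is exactly the slack of [U2] plus twice that of [S2]. *)
rewrite -subr_ge0; apply: le_trans (addr_ge0 U2 (mulr_ge0 (ler0n R 2) S2)) _.
by rewrite le_eqVlt; apply/orP; left; apply/eqP; field.
Qed.

Lemma step_contraction x :
  measurable_fun setT (fun e => norm2 (x - eta *: (gradf e x - c e x) - thetastar) ^+ 2) ->
  (\int[p]_e (norm2 (x - eta *: (gradf e x - c e x) - thetastar) ^+ 2)%:E <=
  ((1 - eta * H * (1 - eta * (2 * L + M))) * norm2 (x - thetastar) ^+ 2)%:E)%E.
Proof.
move=> mstep; set h := x - thetastar.
pose V := fine ('E_p[fun e => (norm2 (gradf e thetastar - c e x) ^+ 2)%R])%E.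
have meanV : has_mean p (fun e => (norm2 (gradf e thetastar - c e x)) ^+ 2) V.
  exact: integrable_has_mean.
have meanD : has_mean p (fun e => f e x - f e thetastar) (F x - F thetastar).
  exact: has_meanB.
have VM : V <= M * (F x - F thetastar).
  have := varc x; rewrite unlock.
  by have [[_ ->] [_ ->]] := (meanV, meanD); rewrite -EFinM lee_fin.
have meanc0 : has_mean p (fun e => dotv (c e x) h) 0.
  have -> : 0 = dotv (0 : 'rV[R]_d) h.
    by rewrite /dotv big1 // => i _; rewrite mxE mul0r.
  apply: has_mean_dotv => i.
  by have := integrable_has_mean p _ (intc x i); rewrite meanc mxE.
have [ib mb] := has_meanD (has_meanB (has_meanD (has_meanD
   (has_mean_cst p ((1 - eta * H) * dotv h h))
   (has_meanZ (4 * L * eta ^+ 2 - 2 * eta) meanD))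
   (has_meanZ (2 * eta) meanc0))
   (has_meanZ (4 * L * eta ^+ 2) (mean_gradient_minimizer h)))
   (has_meanZ (2 * eta ^+ 2) meanV).
apply: (@le_trans _ _ (\int[p]_e ((1 - eta * H) * dotv h h +
  (4 * L * eta ^+ 2 - 2 * eta) * (f e x - f e thetastar) +
  2 * eta * dotv (c e x) h - 4 * L * eta ^+ 2 * dotv (gradf e thetastar) h +
  2 * eta ^+ 2 * norm2 (gradf e thetastar - c e x) ^+ 2)%:E)%E).
  apply: ge0_le_integral => //.
  - by move=> e _; rewrite lee_fin sqr_ge0.
  - exact/measurable_EFinP.
  - exact: measurable_int ib.
  - by move=> e _; rewrite lee_fin; exact: step_sqr_le.
rewrite mb lee_fin !mulr0 addr0 subr0 norm2_sqr.
have LM0 : 0 < 2 * L + M by rewrite addr_gt0 // mulr_gt0.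
have eLM : eta * (2 * L + M) <= 1 by rewrite -ler_pdivlMr.
have D0 : 0 <= F x - F thetastar by rewrite subr_ge0.
have V2 : eta ^+ 2 * V <= eta ^+ 2 * (M * (F x - F thetastar)).
  by rewrite ler_pM2l // exprn_gt0.
(* With [V <= M * D], the coefficient of [D] is [-2 * eta * (1 - eta * (2 * L + M))], nonpositive by
   the step size bound. *)
have slack : 0 <= eta * (1 - eta * (2 * L + M)) * (F x - F thetastar).
  by rewrite !mulr_ge0 ?subr_ge0 // ltW.
(* This is the excess of the contraction factor over [1 - eta * H], times [dotv h h]. *)
have slackH : 0 <= eta * H * (eta * (2 * L + M)) * dotv h h.
  by rewrite !mulr_ge0 ?dotvv_ge0 // ltW.
move: V2 slack slackH; move: (F x - F thetastar) (dotv h h) => D S.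
rewrite !expr2; lra.
Qed.

End one_step.

(** Induction works for [rho >= 0]; a negative [rho] forces the sequence to vanish. The latter can
    occur for [d = 0], where [H] is not bounded by [L]. *)
Lemma geometric_decay (R : realFieldType) (a : nat -> R) (rho : R) :
  (forall t, 0 <= a t) -> (forall t, a t.+1 <= rho * a t) ->
  forall t, a t <= rho ^+ t * a 0%N.
Proof.
move=> a0 aS t; have [rho0|rho0] := leP 0 rho.
  elim: t => [|t IH]; first by rewrite expr0 mul1r.
  by apply: le_trans (aS t) _; rewrite exprS -mulrA ler_wpM2l.
have az s : a s = 0.
  apply/eqP; rewrite eq_le a0 andbT -(nmulr_rge0 _ rho0).
  exact: le_trans (a0 _) (aS s).
by rewrite !az mulr0.
Qed.

(** * Measurability of the update on tuples *)

Section tuple_vectors.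
Context {R : realType} {d : nat}.

Definition tuple_of_mx (v : 'rV[R]_d) : d.-tuple R := [tuple v ord0 i | i < d].

Lemma tuple_of_mxK v : mx_of_tuple (tuple_of_mx v) = v.
Proof. by apply/rowP => i; rewrite mxE tnth_mktuple. Qed.

Lemma measurable_sqdist (v : 'rV[R]_d) :
  measurable_fun setT (fun x : d.-tuple R => norm2 (mx_of_tuple x - v) ^+ 2).
Proof.
under eq_fun do rewrite norm2_sqr.
apply: measurable_sum => i; under eq_fun do rewrite !mxE.
by apply: measurable_funM; apply: measurable_funB => //; exact: measurable_tnth.
Qed.

Context {d0 : measure_display} {E : measurableType d0}.
Variables (gradf c : E -> 'rV[R]_d -> 'rV[R]_d) (eta : R).

(** Acts on tuples because they carry the product sigma-algebra; it serves as [Phi] in the recursion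
    lemmas. *)
Definition sgd_step (z : E * d.-tuple R) : d.-tuple R :=
  let x := mx_of_tuple z.2 in
  tuple_of_mx (x - eta *: (gradf z.1 x - c z.1 x)).

Lemma measurable_sgd_step :
  (forall i, measurable_fun setT
      (fun z : E * d.-tuple R => gradf z.1 (mx_of_tuple z.2) ord0 i)) ->
  (forall i, measurable_fun setT
      (fun z : E * d.-tuple R => c z.1 (mx_of_tuple z.2) ord0 i)) ->
  measurable_fun setT sgd_step.
Proof.
move=> mg mc; apply/measurable_fun_tnthP => i.
have -> : (@tnth d R)^~ i \o sgd_step = fun z => tnth z.2 i -
    eta * (gradf z.1 (mx_of_tuple z.2) ord0 i - c z.1 (mx_of_tuple z.2) ord0 i).
  by apply/funext => z; rewrite /= tnth_mktuple !mxE.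
apply: measurable_funB.
  by apply: (@measurableT_comp _ _ _ _ _ _ (fun x => tnth x i)) => //; exact: measurable_tnth.
by apply: measurable_funM => //; exact: measurable_funB.
Qed.

End tuple_vectors.

Theorem mainTheorem2
  (R : realType) (d : nat)
  (d0 : measure_display) (E : measurableType d0) (p : probability E R)
  (d1 : measure_display) (T : measurableType d1) (P : probability T R)
  (f : E -> 'rV[R]_d -> R) (gradf c : E -> 'rV[R]_d -> 'rV[R]_d)
  (thetastar theta0 : 'rV[R]_d) (L H M eta : R)
  (eps : nat -> T -> E) :
  (* finiteness of the expectations *)
  (forall theta, p.-integrable setT (fun e => (f e theta)%:E)) ->
  (forall theta i, p.-integrable setT (fun e => (gradf e theta ord0 i)%:E)) ->
  (forall theta i, p.-integrable setT (fun e => (c e theta ord0 i)%:E)) ->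
  (forall theta, p.-integrable setT
      (fun e => ((norm2 (gradf e thetastar - c e theta)) ^+ 2)%:E)) ->
  (forall t, P.-integrable setT
      (fun w => ((norm2 (sgd_iter gradf c eps eta theta0 t w - thetastar)) ^+ 2)%:E)) ->
  (* joint measurability of the gradient and of the control variate *)
  (forall i, measurable_fun setT
      (fun z : E * d.-tuple R => gradf z.1 (mx_of_tuple z.2) ord0 i)) ->
  (forall i, measurable_fun setT
      (fun z : E * d.-tuple R => c z.1 (mx_of_tuple z.2) ord0 i)) ->
  (* thetastar minimizes F(theta) = E_p[f(eps, theta)] *)
  (forall theta, ('E_p[fun e => f e thetastar] <= 'E_p[fun e => f e theta])%E) ->
  (* gradient and expectation may be interchanged *)
  (forall theta, is_gradient (fun th => fine ('E_p[fun e => f e th])%E) theta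
      (\row_i fine ('E_p[fun e => gradf e theta ord0 i])%E)) ->
  (* control variate has zero mean *)
  (forall theta i, ('E_p[fun e => c e theta ord0 i] = 0)%E) ->
  0 < L -> 0 < H -> 0 < M ->
  (* (A1) differentiability and L-smoothness *)
  (forall e theta, is_gradient (f e) theta (gradf e theta)) ->
  (forall e theta theta', norm2 (gradf e theta - gradf e theta') <= L * norm2 (theta - theta')) ->
  (* (A2) H-strong convexity *)
  (forall e, strongly_convex H (f e)) ->
  (* (A3) *)
  (forall theta, ('E_p[fun e => ((norm2 (gradf e thetastar - c e theta)) ^+ 2)%R]
                  <= M%:E * 'E_p[fun e => (f e theta - f e thetastar)%R])%E) ->
  (* eps_0, eps_1, ... i.i.d. with law p *)
  (forall t, measurable_fun setT (eps t)) ->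
  mutually_independent P eps ->
  identically_distributed P p eps ->
  0 < eta -> eta <= 1 / (2 * L + M) ->
  forall t : nat,
    ('E_P[fun w => ((norm2 (sgd_iter gradf c eps eta theta0 t w - thetastar)) ^+ 2)%R]
      <= ((1 - eta * H * (1 - eta * (2 * L + M))) ^+ t
          * (norm2 (theta0 - thetastar)) ^+ 2)%R%:E)%E.
Proof.
move=> intf intg intc intv intX mg mc fmin _ meanc L0 H0 M0 gradP lip cvx varc
  meps indep idist eta0 eta1.
set rho := 1 - _.
pose X t w := tuple_of_mx (sgd_iter gradf c eps eta theta0 t w).
have XK t w : mx_of_tuple (X t w) = sgd_iter gradf c eps eta theta0 t w.
  exact: tuple_of_mxK.
have X0 : X 0 = cst (tuple_of_mx theta0) by [].
have XS t w : X t.+1 w = sgd_step gradf c eta (eps t w, X t w).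
  by rewrite /sgd_step /= XK.
have mstep := measurable_sgd_step _ _ eta mg mc.
have mX := measurable_recursion eps X _ _ meps mstep X0 XS.
pose q (x : d.-tuple R) := norm2 (mx_of_tuple x - thetastar) ^+ 2.
have q0 x : 0 <= q x by exact: sqr_ge0.
have mq : measurable_fun setT q by exact: measurable_sqdist.
have mqs : measurable_fun setT (q \o sgd_step gradf c eta) by exact: measurableT_comp.
have contraction x : (\int[p]_e (q (sgd_step gradf c eta (e, x)))%:E <=
    (rho * q x)%:E)%E.
  have qE e : q (sgd_step gradf c eta (e, x)) = norm2 (mx_of_tuple x -
      eta *: (gradf e (mx_of_tuple x) - c e (mx_of_tuple x)) - thetastar) ^+ 2.
    by rewrite /q tuple_of_mxK.
  under eq_integral do rewrite qE.
  apply: (step_contraction p f gradf c thetastar L H M eta) => //.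
  under eq_fun do rewrite -qE.
  exact: (measurableT_comp mqs (measurable_pair2 x)).
(* The sign of [rho] is not at hand; nonnegativity follows since the product bounds a nonnegative
   integral. *)
have rhoq0 x : 0 <= rho * q x.
  rewrite -lee_fin; apply: le_trans (contraction x).
  by apply: integral_ge0 => e _; rewrite lee_fin.
have qX t : ('E_P[fun w => ((norm2 (sgd_iter gradf c eps eta theta0 t w - thetastar)) ^+ 2)%R]
    = \int[P]_w (q (X t w))%:E)%E.
  by rewrite unlock; apply: eq_integral => w _; rewrite /q XK.
have iqX t : P.-integrable setT (fun w => (q (X t w))%:E).
  by under eq_fun do rewrite /q XK; exact: intX.
have recur t : (\int[P]_w (q (X t.+1 w))%:E <= rho%:E * \int[P]_w (q (X t w))%:E)%E.
  pose Xt : {mfun T >-> d.-tuple R} :=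
    HB.pack (X t) (isMeasurableFun.Build _ _ _ _ _ (mX t)).
  rewrite (recursion_ge0_expectation p P eps X _ _ meps indep idist mstep X0 XS t Xt) //.
  rewrite -integralZl //.
  apply: (@le_trans _ _ (\int[distribution P Xt]_x (rho * q x)%:E)%E).
    apply: ge0_le_integral => //.
    - by move=> x _; apply: integral_ge0 => e _; rewrite lee_fin.
    - have mqsE : measurable_fun setT (fun z => (q (sgd_step gradf c eta z))%:E).
        exact/measurable_EFinP.
      apply: (measurable_fun_fubini_tonelli_G (fun z => (q (sgd_step gradf c eta z))%:E)).
        exact: mqsE.
      by move=> z; rewrite lee_fin.
    - by apply/measurable_EFinP; apply: measurable_funM.
  rewrite ge0_integral_distribution //.
  by apply/measurable_EFinP; apply: measurable_funM.
move=> t.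
(* Finiteness turns the recursion into one between real numbers. *)
have fin s : (\int[P]_w (q (X s w))%:E)%E \is a fin_num by exact: integrable_fin_num.
pose a s := fine (\int[P]_w (q (X s w))%:E)%E.
rewrite qX. rewrite -(fineK (fin t)). rewrite lee_fin -/(a t).
have -> : norm2 (theta0 - thetastar) ^+ 2 = a 0%N.
  by rewrite /a /q X0 /= tuple_of_mxK integral_cst //= probability_setT mule1.
apply: geometric_decay => s.
  by apply: fine_ge0; apply: integral_ge0 => w _; rewrite lee_fin.
by rewrite -lee_fin EFinM !fineK.
Qed.
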